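(* Let $\mathcal{H}$ be a hypergraph with $n$ vertices, $m$ edges and rank $r$, and let $\lambda_1\geq\lambda_2\geq\cdots\geq\lambda_n$ be the eigenvalues of its signless Laplacian matrix (with multiplicity), where $\lambda_i>0$ for $i\leq p$ and $\lambda_i=0$ for $i>p$. For integers $t\geq1$ and $k>rt$, the eigenvalues (with multiplicity) of the signless Laplacian matrix of the power hypergraph $\mathcal{H}^k_t$ are: (i) $t\lambda_1+(k-rt),\ \ldots,\ t\lambda_p+(k-rt)$; (ii) $k-rt$ with multiplicity $m-p$; (iii) $0$ with multiplicity $(k-rt-1)m+tn$.
   Context: A hypergraph $\mathcal{H}=(V,E)$ consists of a finite set $V$ of vertices and a set $E$ of non-empty subsets of $V$, called hyperedges. All hypergraphs are assumed simple (no hyperedge has cardinality one and no hyperedge is contained in another) and connected (any two vertices are joined by a path, i.e. an alternating sequence of distinct vertices and hyperedges in which each hyperedge contains the vertices immediately before and after it). The rank of $\mathcal{H}$ is the largest cardinality of its hyperedges (so $E\neq\emptyset$ when the rank is mentioned). The incidence matrix $\mathbf{B}$ of a hypergraph is the $|V|\times|E|$ matrix with $(v,e)$ entry $1$ if $v\in e$ and $0$ otherwise; the signless Laplacian matrix is the $|V|\times|V|$ matrix $\mathbf{Q}=\mathbf{B}\mathbf{B}^{\mathrm{T}}$. General power hypergraph: for a hypergraph $\mathcal{H}=(V,E)$ with rank $r$ and integers $t\geq1$, $q\geq0$, put $k=tr+q$. The hypergraph $\mathcal{H}^k_t$ is obtained as follows. Each vertex $v\in V$ is replaced by a set $\tau_v$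 of $t$ vertices, and for each hyperedge $e\in E$ a set $\tau_e$ of $q=k-rt$ new vertices is introduced; all the sets $\tau_v$ ($v\in V$) and $\tau_e$ ($e\in E$) are pairwise disjoint, and their union is the vertex set of $\mathcal{H}^k_t$. The hyperedges of $\mathcal{H}^k_t$ are the sets $e^k_t=\tau_e\cup\bigcup_{v\in e}\tau_v$, one for each $e\in E$ (so each vertex of $\tau_e$ has degree one). The number $q$ of added vertices is the same for every hyperedge, regardless of $|e|$. *)

(* Defs.v *)
From HB Require Import structures.
From mathcomp Require Import all_boot all_order all_algebra.

Set Implicit Arguments.
Unset Strict Implicit.
Unset Printing Implicit Defensive.

Import Order.TTheory GRing.Theory Num.Theory.
Local Open Scope ring_scope.

(* A hypergraph is a finite vertex type V together with its set of hyperedges *)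
(* E : {set {set V}} satisfying is_hypergraph E.                              *)
Definition is_hypergraph (V : finType) (E : {set {set V}}) : Prop :=
  forall e, e \in E -> e != set0.

Definition simple_hypergraph (V : finType) (E : {set {set V}}) : Prop :=
  (forall e, e \in E -> #|e| <> 1%N) /\
  (forall e f, e \in E -> f \in E -> e \subset f -> e = f).

(* The alternating sequence x, e1, y1, ..., el, yl is encoded by its first    *)
(* vertex x and the list s = [:: (e1, y1); ...; (el, yl)].                    *)
Fixpoint alternating (V : finType) (E : {set {set V}}) (x : V)
    (s : seq ({set V} * V)) : bool :=
  if s is (e, y) :: s' then
    [&& e \in E, x \in e, y \in e & alternating E y s']
  else true.

Definition is_hpath (V : finType) (E : {set {set V}}) (x y : V)
    (s : seq ({set V} * V)) : bool :=
  [&& alternating E x s, uniq (x :: unzip2 s), uniq (unzip1 s)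
    & last x (unzip2 s) == y].

Definition connected_hypergraph (V : finType) (E : {set {set V}}) : Prop :=
  forall x y : V, exists s, is_hpath E x y s.

Definition rank (V : finType) (E : {set {set V}}) : nat :=
  (\max_(e in E) #|e|)%N.

(* Rows and columns follow the canonical enumerations of V and E.             *)
Definition incidence_mx (R : nzRingType) (V : finType) (E : {set {set V}}) :
    'M[R]_(#|V|, #|E|) :=
  \matrix_(i < #|V|, j < #|E|) (enum_val i \in (enum_val j : {set V}))%:R.

Definition signless_laplacian (R : nzRingType) (V : finType)
    (E : {set {set V}}) : 'M[R]_#|V| :=
  incidence_mx R E *m (incidence_mx R E)^T.

(* s lists the eigenvalues of A, each repeated according to its multiplicity  *)
(* as a root of the characteristic polynomial.                                *)
Definition has_spectrum (R : comNzRingType) (n : nat) (A : 'M[R]_n)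
    (s : seq R) : Prop :=
  char_poly A = \prod_(a <- s) ('X - a%:P).

Section GeneralPower.
Variables (V : finType) (E : {set {set V}}) (t k : nat).

(* Truncated subtraction: only meaningful when rank E * t <= k.               *)
Definition extra : nat := (k - rank E * t)%N.

(* inl (v, i) is the i-th copy of v; inr (e, j) is the j-th vertex added to   *)
(* the hyperedge e.                                                           *)
Definition power_vertex : finType :=
  ((V * 'I_t) + ({e : {set V} | e \in E} * 'I_extra))%type.

Definition tau_vertex (v : V) : {set power_vertex} :=
  [set (inl (v, i) : power_vertex) | i : 'I_t].

Definition tau_edge (e : {e : {set V} | e \in E}) : {set power_vertex} :=
  [set (inr (e, j) : power_vertex) | j : 'I_extra].

Definition power_edge (e : {e : {set V} | e \in E}) : {set power_vertex} :=
  tau_edge e :|: \bigcup_(v in val e) tau_vertex v.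

Definition power_edges : {set {set power_vertex}} :=
  [set power_edge e | e : {e : {set V} | e \in E}].

End GeneralPower.

(* Main.v *)
(** The nonzero spectrum of B B^T agrees with that of B^T B (Sylvester).  The
    Gram matrix B^T B has entries |e ∩ f|; in the power hypergraph these become
    t |e ∩ f| + (k - rt) [e = f], so the Gram matrix of the power hypergraph is
    t B^T B + (k - rt) I, up to the enumeration of the hyperedges, and its
    spectrum is the image of that of B^T B under x |-> t x + (k - rt). *)
Require Import Defs.
From HB Require Import structures.
From mathcomp Require Import all_boot all_order all_algebra fingroup perm.

Set Implicit Arguments.
Unset Strict Implicit.
Unset Printing Implicit Defensive.

Import Order.TTheory GRing.Theory Num.Theory.
Local Open Scope ring_scope.

(* Both sides compute det [x, B; C, 1] * x ^+ m. *)
Lemma det_scalar_sub_mulmxC (R : comNzRingType) n m (x : R)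
    (B : 'M[R]_(n, m)) (C : 'M[R]_(m, n)) :
  x ^+ m * \det (x%:M - B *m C) = x ^+ n * \det (x%:M - C *m B).
Proof.
set M := block_mx x%:M B C 1%:M.
have detM : \det M = \det (x%:M - B *m C).
  have := det_mulmx M (block_mx 1%:M 0 (- C) 1%:M).
  rewrite det_lblock !det1 !mulr1 => <-.
  rewrite mulmx_block !mulmx1 !mulmx0 mulmxN mul1mx subrr !add0r.
  by rewrite det_ublock det1 mulr1.
(* The multiplier used for [detM] clears the block [C]; this one clears [B], and its determinant
   supplies the factor [x ^+ m]. *)
have := det_mulmx M (block_mx 1%:M (- B) 0 x%:M).
rewrite mulmx_block !mulmx1 !mulmx0 !addr0 mul1mx !mulmxN.
rewrite mul_mx_scalar mul_scalar_mx addNr det_lblock det_ublock det1 mul1r.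
by rewrite !det_scalar detM addrC mulrC [X in _ = X]mulrC => <-; rewrite mulrC.
Qed.

(** The determinant identity over the polynomial ring, at [x = 'X]. *)
Lemma char_poly_mulmxC (R : comNzRingType) n m
    (B : 'M[R]_(n, m)) (C : 'M[R]_(m, n)) :
  'X^m * char_poly (B *m C) = 'X^n * char_poly (C *m B).
Proof.
by rewrite /char_poly /char_poly_mx !map_mxM; apply: det_scalar_sub_mulmxC.
Qed.

(** Renaming the indices conjugates the characteristic matrix by a permutation matrix. The sizes are
    kept distinct because [#|E|] and the number of power hyperedges are only provably equal. *)
Lemma char_poly_reindex (R : comNzRingType) n m (f : 'I_n -> 'I_m)
    (A : 'M[R]_n) (B : 'M[R]_m) :
  n = m -> injective f -> (forall i j, A i j = B (f i) (f j)) ->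
  char_poly A = char_poly B.
Proof.
move=> eq_nm; case: _ / eq_nm f B => f B f_inj AE.
set s := perm f_inj.
have -> : char_poly A = \det (row_perm s (col_perm s (char_poly_mx B))).
  by congr (\det _); apply/matrixP => i j; rewrite !mxE !permE AE (inj_eq f_inj).
rewrite row_permE col_permE !det_mulmx mulrCA -det_mulmx -perm_mxM mulgV.
by rewrite perm_mx1 det1 mulr1.
Qed.

Lemma has_spectrum_affine (F : fieldType) n (A : 'M[F]_n) (s : seq F) (a b : F) :
  a != 0 -> has_spectrum A s ->
  has_spectrum (a *: A + b%:M) [seq a * c + b | c <- s].
Proof.
move=> a_neq0 sA.
have size_s : size s = n.
  by have := size_char_poly A; rewrite sA size_prod_XsubC => -[].
(* [g] inverts [x |-> a * x + b]; substituting it for ['X] in [char_poly A] gives the new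
   characteristic polynomial up to the factor [a ^+ n]. *)
pose g : {poly F} := a^-1 *: ('X - b%:P).
have ag c : a%:P * (g - c%:P) = 'X - (a * c + b)%:P.
  rewrite mulrBr -polyCM mul_polyC scalerA mulfV // scale1r polyCD.
  by rewrite opprD addrA addrAC.
rewrite /has_spectrum big_map.
under eq_bigr => c _ do rewrite -ag.
rewrite big_split /= big_const_seq count_predT iter_mulr_1 size_s.
have -> : \prod_(c <- s) (g - c%:P) = char_poly A \Po g.
  rewrite sA rmorph_prod /=; apply: eq_bigr => c _.
  by rewrite comp_polyB comp_polyX comp_polyC.
rewrite -det_map_mx -detZ; congr (\det _); apply/matrixP => i j.
rewrite !mxE; case: (i == j); rewrite ?mulr1n ?mulr0n ?add0r ?addr0 /=.
  by rewrite rmorphB /= comp_polyX comp_polyC ag.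
rewrite rmorphN /= comp_polyC mulrN.
by rewrite -polyCM.
Qed.

Lemma prod_nseq_XsubC (R : nzRingType) (a : R) m :
  \prod_(c <- nseq m a) ('X - c%:P) = ('X - a%:P) ^+ m.
Proof. by rewrite big_nseq iter_mulr_1. Qed.

(** Both characteristic polynomials agree up to powers of ['X], and the product [P] over the nonzero
    eigenvalues does not vanish at 0, so comparing powers of ['X] bounds [size s] and fixes the
    multiplicity of 0. *)
Lemma gram_nonzero_spectrum (F : fieldType) n m (B : 'M[F]_(n, m))
    (s : seq F) z :
  0 \notin s -> has_spectrum (B *m B^T) (s ++ nseq z 0) ->
  (size s <= m)%N /\ has_spectrum (B^T *m B) (s ++ nseq (m - size s) 0).
Proof.
move=> s_neq0 sB.
have n_sz : n = (size s + z)%N.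
  have := size_char_poly (B *m B^T).
  by rewrite sB size_prod_XsubC size_cat size_nseq => -[].
have := char_poly_mulmxC B B^T.
rewrite sB big_cat prod_nseq_XsubC subr0 /=.
set P := \prod_(_ <- _) _; set c := char_poly _ => eqc.
have P0 : P.[0] != 0 by rewrite -/(root P 0) root_prod_XsubC.
have eqc' : 'X^m * P = 'X^(size s) * c.
  apply: (@mulfI _ 'X^z); first by rewrite monic_neq0 ?monicXn.
  by rewrite mulrCA ['X^z * P]mulrC eqc n_sz exprD mulrA ['X^z * _]mulrC.
have le_sm : (size s <= m)%N.
  (* Otherwise a positive power of ['X] would divide [P]. *)
  rewrite leqNgt; apply: contra P0 => lt_ms.
  have -> : P = 'X^(size s - m) * c.
    apply: (@mulfI _ 'X^m); first by rewrite monic_neq0 ?monicXn.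
    by rewrite eqc' mulrA -exprD subnKC // ltnW.
  by rewrite hornerM hornerXn expr0n subn_eq0 leqNgt lt_ms mul0r.
split=> //; rewrite /has_spectrum big_cat prod_nseq_XsubC subr0 -/P /=.
apply: (@mulfI _ 'X^(size s)); first by rewrite monic_neq0 ?monicXn.
by rewrite -eqc' mulrCA -exprD subnKC // mulrC.
Qed.

Lemma gram_incidence (R : nzRingType) (V : finType) (E : {set {set V}})
    (i j : 'I_#|E|) :
  ((incidence_mx R E)^T *m incidence_mx R E) i j =
    #|enum_val i :&: enum_val j|%:R.
Proof.
rewrite mxE -[in RHS]sum1_card natr_sum [RHS]big_mkcond /=.
rewrite [RHS](reindex (@enum_val V V)) /=; last exact: onW_bij (@enum_val_bij V).
apply: eq_bigr => v _; rewrite !mxE in_setI.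
by case: (_ \in _); case: (_ \in _); rewrite ?mulr0 ?mul0r ?mul1r.
Qed.

Section PowerEdge.
Variables (V : finType) (E : {set {set V}}) (t k : nat).
Implicit Types e f : {e : {set V} | e \in E}.

Lemma inl_power_edge e v i :
  (inl (v, i) \in power_edge t k e) = (v \in val e).
Proof.
rewrite in_setU; apply/orP/idP => [[/imsetP[j _] //|] | ve].
  by case/bigcupP=> w we /imsetP[j _ [-> _]].
by right; apply/bigcupP; exists v => //; apply: imset_f.
Qed.

Lemma inr_power_edge e f j : (inr (f, j) \in power_edge t k e) = (f == e).
Proof.
rewrite in_setU; apply/orP/eqP => [[/imsetP[l _ [-> _]] //|] | ->].
  by case/bigcupP=> w we /imsetP[].
by left; apply: imset_f.
Qed.

(** Copies and added vertices are counted separately: each common vertex contributes its [t] copies,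
    while an added vertex lies in one hyperedge only. *)
Lemma card_power_edgeI e f :
  #|power_edge t k e :&: power_edge t k f| =
    (t * #|val e :&: val f| + (k - rank E * t) * (e == f))%N.
Proof.
rewrite -!sum1_card big_mkcond big_sumType /=; congr (_ + _)%N.
  transitivity (\sum_(u : V * 'I_t) (u.1 \in val e :&: val f))%N.
    by apply: eq_bigr => -[v i] _; rewrite !in_setI !inl_power_edge; case: andP.
  rewrite -(pair_bigA _ (fun v _ => nat_of_bool (v \in val e :&: val f))) /=.
  rewrite big_distrr [RHS]big_mkcond /=; apply: eq_bigr => v _.
  by rewrite sum_nat_const card_ord; case: ifP; rewrite ?muln0.
transitivity (\sum_(u : {e | e \in E} * 'I_(extra E t k))
                ((u.1 == e) && (u.1 == f)))%N.
  by apply: eq_bigr => -[g i] _; rewrite !in_setI !inr_power_edge; case: andP.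
rewrite -(pair_bigA _ (fun g _ => nat_of_bool ((g == e) && (g == f)))) /=.
rewrite (bigD1 e) //= eqxx sum_nat_const card_ord big1 ?addn0 // => g /negPf->.
by rewrite big1.
Qed.

Hypothesis k_gt : (rank E * t < k)%N.

(** As [k] strictly exceeds [rank E * t], every power hyperedge has an added vertex, which
    identifies it. *)
Lemma power_edge_inj : injective (@power_edge V E t k).
Proof.
move=> e f eq_ef; have q_gt0 : (0 < extra E t k)%N by rewrite subn_gt0.
by apply/eqP; rewrite -(inr_power_edge f e (Ordinal q_gt0)) -eq_ef inr_power_edge.
Qed.

Lemma card_power_edges : #|power_edges E t k| = #|E|.
Proof. by rewrite card_imset ?card_sig //; apply: power_edge_inj. Qed.

(** Stated for characteristic polynomials since the power hyperedges carry their own enumeration;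
    [f] below matches it with that of [E]. *)
Lemma char_poly_gram_power (R : comNzRingType) :
  let B := incidence_mx R E in let Bt := incidence_mx R (power_edges E t k) in
  char_poly (Bt^T *m Bt) =
    char_poly (t%:R *: (B^T *m B) + (k - rank E * t)%:R%:M).
Proof.
move=> B Bt; symmetry.
pose e (i : 'I_#|E|) : {e : {set V} | e \in E} := Sub (enum_val i) (enum_valP i).
have in_pe i : power_edge t k (e i) \in power_edges E t k by apply: imset_f.
pose f i := enum_rank_in (in_pe i) (power_edge t k (e i)).
have fK i : enum_val (f i) = power_edge t k (e i) by rewrite enum_rankK_in.
have e_inj : injective e by move=> i j /(congr1 val) /enum_val_inj.
apply: (@char_poly_reindex _ _ _ f).
- by rewrite card_power_edges.
- by move=> i j /(congr1 enum_val); rewrite !fK => /power_edge_inj /e_inj.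
move=> i j; rewrite gram_incidence !fK card_power_edgeI natrD !natrM.
by rewrite mxE [X in X + _]mxE gram_incidence mxE (inj_eq e_inj) !mulr_natr.
Qed.

Lemma card_power_vertex :
  #|power_vertex E t k| = (t * #|V| + (k - rank E * t) * #|E|)%N.
Proof.
by rewrite card_sum !card_prod !card_ord card_sig mulnC [X in (_ + X)%N]mulnC.
Qed.

End PowerEdge.

(* The index i : 'I_#|V| starts at 0, so lambda i is the (i + 1)-st eigenvalue. *)
Theorem theorem5p11 (R : rcfType) (V : finType) (E : {set {set V}})
    (hE : is_hypergraph E) (E_neq0 : E != set0)
    (E_simple : simple_hypergraph E) (E_conn : connected_hypergraph E)
    (lambda : 'I_#|V| -> R) (p : nat) (t k : nat)
    (spec_lambda : has_spectrum (signless_laplacian R E)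
                     [seq lambda i | i : 'I_#|V|])
    (lambda_dec : forall i j : 'I_#|V|, (i <= j)%N -> lambda j <= lambda i)
    (le_p_n : (p <= #|V|)%N)
    (lambda_pos : forall i : 'I_#|V|, (i < p)%N -> 0 < lambda i)
    (lambda_zero : forall i : 'I_#|V|, (p <= i)%N -> lambda i = 0)
    (t_ge1 : (1 <= t)%N) (k_gt : (rank E * t < k)%N) :
  (p <= #|E|)%N /\
  has_spectrum (signless_laplacian R (power_edges E t k))
    ([seq t%:R * lambda i + (k - rank E * t)%:R | i : 'I_#|V| <- enum 'I_#|V| & (i < p)%N]
     ++ nseq (#|E| - p) (k - rank E * t)%:R
     ++ nseq ((k - rank E * t - 1) * #|E| + t * #|V|) 0).
Proof.
set q := (k - rank E * t)%N.
set s := [seq lambda i | i : 'I_#|V| <- enum 'I_#|V| & (i < p)%N].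
pose lt_p := [pred i : 'I_#|V| | (i < p)%N].
have card_lt_p : #|lt_p| = p.
  rewrite -sum1_card -(big_ord_widen _ (fun=> 1%N)) //.
  by rewrite sum_nat_const card_ord muln1.
have size_s : size s = p.
  by rewrite -[RHS]card_lt_p cardE size_map enumT.
have s_neq0 : 0 \notin s.
  apply/mapP=> -[i]; rewrite mem_filter => /andP[ip _] l0.
  by have := lambda_pos i ip; rewrite -l0 ltxx.
(* Splitting the product at index [p] separates the positive eigenvalues from the zeros. *)
have spec_s : has_spectrum (signless_laplacian R E) (s ++ nseq (#|V| - p) 0).
  rewrite /has_spectrum spec_lambda big_cat big_map big_enum /=.
  rewrite (bigID (fun i : 'I_#|V| => (i < p)%N)) /=; congr (_ * _).
    by rewrite big_map big_filter big_enum_cond.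
  rewrite (eq_bigr (fun=> 'X - 0%:P)); last first.
    by move=> i; rewrite -leqNgt => /lambda_zero ->.
  rewrite prod_nseq_XsubC prodr_const; congr (_ ^+ _).
  by rewrite -[in RHS](card_ord #|V|) -(cardC lt_p) card_lt_p addKn.
have [le_pm] := gram_nonzero_spectrum s_neq0 spec_s.
rewrite size_s in le_pm *.
have t_neq0 : t%:R != 0 :> R by rewrite pnatr_eq0 -lt0n.
(* The [#|E| - p] zeros of the Gram spectrum are sent to [q], which gives family (ii). *)
move=> /(has_spectrum_affine q%:R t_neq0).
rewrite map_cat map_nseq mulr0 add0r -map_comp /has_spectrum.
rewrite -char_poly_gram_power // => specG; split=> //.
(* This factor allows the return from the Gram matrix to the signless Laplacian. *)
apply: (@mulfI _ 'X^#|power_edges E t k|); first by rewrite monic_neq0 ?monicXn.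
rewrite char_poly_mulmxC specG card_power_edges // card_power_vertex -/q.
have q_gt0 : (0 < q)%N by rewrite subn_gt0.
rewrite !big_cat !prod_nseq_XsubC subr0 /= !mulrA.
rewrite [RHS]mulrC mulrA mulrA -exprD.
congr ('X^_ * _ * _).
(* The exponents of ['X] agree: [m + (q - 1) * m + t * n = t * n + q * m] for [m = #|E|] and
   [n = #|V|]; the truncated [q - 1] is exact as [q > 0]. *)
by rewrite mulnBl mul1n addnAC subnK ?leq_pmull // addnC.
Qed.
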